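(* Let $D$ be an integral domain with quotient field $F$, and let $\mathcal{K}(D)$ be the ordered monoid of all nonzero $D$-submodules of $F$. A self-map $\star$ of $\mathcal{K}(D)$ is a semistar operation on $D$ if and only if it is a nucleus on the near multiplicative lattice $\mathcal{K}(D)$. Moreover, the following are equivalent for any self-map $\star$ of $\mathcal{K}(D)$. (1) $\star$ is a semistar operation on $D$. (2) $\star$ is a closure operation on the poset $\mathcal{K}(D)$ and $\star$-multiplication $(I,J)\mapsto (IJ)^\star$ on $\mathcal{K}(D)$ is associative. (3) $\star$ is a closure operation on the poset $\mathcal{K}(D)$ and $(I^\star J^\star)^\star = (IJ)^\star$ for all $I,J \in \mathcal{K}(D)$. (4) For all $I,J,K \in \mathcal{K}(D)$, one has $IJ \subset K^\star$ if and only if $I J^\star \subset K^\star$.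
   Context: For a self-map $\star$ of a set $X$, write $x^\star=\star(x)$. $\mathcal{K}(D)$ is ordered by inclusion, with the usual multiplication of $D$-submodules ($IJ$ is the set of finite sums of products $xy$ with $x\in I$, $y\in J$). A near multiplicative lattice is a commutative monoid $M$ with a partial order such that $x\le x'$, $y\le y'$ imply $xy\le x'y'$, every nonempty subset of $M$ has a supremum, and $a\bigvee X=\bigvee(aX)$ for all $a\in M$ and all nonempty $X\subset M$; $\mathcal{K}(D)$ is a near multiplicative lattice. A closure operation on a poset $S$ is a self-map $\star$ of $S$ that is expansive ($x\le x^\star$), order-preserving, and idempotent. A nucleus on an ordered magma $M$ (a magma with a partial order compatible with multiplication) is a closure operation $\star$ on $M$ with $x^\star y^\star\le (xy)^\star$ for all $x,y\in M$. A semistar operation on $D$ is a closure operation $\star$ on the poset $\mathcal{K}(D)$ such that $(aI)^\star=aI^\star$ for all nonzero $a\in F$ and all $I\in\mathcal{K}(D)$. *)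

(* Defs.v *)
From HB Require Import structures.
From mathcomp Require Import all_boot all_order all_algebra.
From mathcomp Require Import boolp classical_sets.

Set Implicit Arguments.
Unset Strict Implicit.
Unset Printing Implicit Defensive.

Import Order.TTheory GRing.Theory.
Local Open Scope classical_set_scope.

HB.mixin Record isOrderedMagma (d : Order.disp_t) M
    of Magma M & Order.POrder d M := {
  leM : forall x x' y y' : M,
    (x <= x')%O -> (y <= y')%O -> ((x * y)%g <= (x' * y')%g)%O
}.

#[short(type="orderedMagmaType")]
HB.structure Definition OrderedMagma (d : Order.disp_t) :=
  { M of isOrderedMagma d M & Magma M & Order.POrder d M }.

(* Suprema are only required to exist, and only for nonempty subsets. *)
HB.mixin Record isNearMultLattice (d : Order.disp_t) M
    of Monoid M & Order.POrder d M := {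
  nmlC : commutative (fun x y : M => (x * y)%g);
  nml_sup : forall X : set M, X !=set0 -> supremums X !=set0;
  nml_supM : forall (a : M) (X : set M) (s : M), X !=set0 ->
    supremums X s -> supremums [set (a * x)%g | x in X] (a * s)%g
}.

#[short(type="nearMultLatticeType")]
HB.structure Definition NearMultLattice (d : Order.disp_t) :=
  { M of isNearMultLattice d M & Monoid M & OrderedMagma d M }.

Definition closure_operation (d : Order.disp_t) (S : porderType d)
    (star : S -> S) : Prop :=
  [/\ forall x, (x <= star x)%O,
      forall x y, (x <= y)%O -> (star x <= star y)%O &
      forall x, star (star x) = star x].

Definition nucleus (d : Order.disp_t) (M : orderedMagmaType d)
    (star : M -> M) : Prop :=
  closure_operation star /\
  forall x y : M, ((star x * star y)%g <= star (x * y)%g)%O.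

Definition star_mul (M : magmaType) (star : M -> M) (x y : M) : M :=
  star (x * y)%g.

Local Open Scope ring_scope.

(* The quotient field is {fraction D}, with D embedded by FracField.tofrac.
   Closure under opposites follows from closure under scaling. *)
Definition is_nzsubmod (D : idomainType) (I : set {fraction D}) : Prop :=
  [/\ I 0,
      forall x y, I x -> I y -> I (x + y),
      forall (r : D) x, I x -> I (FracField.tofrac r * x) &
      exists2 x, I x & x != 0].

Record nzsubmod (D : idomainType) := NzSubmod {
  nzsubmod_set :> {fraction D} -> Prop;
  nzsubmodP : is_nzsubmod nzsubmod_set
}.

Lemma nzsubmod_inj (D : idomainType) (I J : nzsubmod D) :
  nzsubmod_set I = nzsubmod_set J -> I = J.
Proof.
case: I J => [I pI] [J pJ] /= E; case: _ / E in pJ *.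
by rewrite (Prop_irrelevance pI pJ).
Qed.

HB.instance Definition _ (D : idomainType) := gen_eqMixin (nzsubmod D).
HB.instance Definition _ (D : idomainType) := gen_choiceMixin (nzsubmod D).

Definition nzsubmod_le (D : idomainType) (I J : nzsubmod D) : bool :=
  `[< nzsubmod_set I `<=` nzsubmod_set J >].

Lemma nzsubmod_le_refl (D : idomainType) : reflexive (@nzsubmod_le D).
Proof. by move=> I; apply/asboolP. Qed.

Lemma nzsubmod_le_anti (D : idomainType) : antisymmetric (@nzsubmod_le D).
Proof.
move=> I J /andP[/asboolP IJ /asboolP JI]; apply: nzsubmod_inj.
exact/seteqP.
Qed.

Lemma nzsubmod_le_trans (D : idomainType) : transitive (@nzsubmod_le D).
Proof.
move=> J I K /asboolP IJ /asboolP JK; apply/asboolP.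
exact: subset_trans IJ JK.
Qed.

Fact nzsubmod_display : Order.disp_t. Proof. exact: Order.Disp tt tt. Qed.

HB.instance Definition _ (D : idomainType) :=
  Order.Le_isPOrder.Build nzsubmod_display (nzsubmod D)
    (@nzsubmod_le_refl D) (@nzsubmod_le_anti D) (@nzsubmod_le_trans D).

Lemma nzsubmod_leP (D : idomainType) (I J : nzsubmod D) :
  reflect (nzsubmod_set I `<=` nzsubmod_set J) (I <= J)%O.
Proof. exact: asboolP. Qed.

Lemma nzsubmod_sum (D : idomainType) (I : nzsubmod D) (T : eqType)
    (s : seq T) (f : T -> {fraction D}) :
  (forall t, t \in s -> I (f t)) -> I (\sum_(t <- s) f t).
Proof.
case: (nzsubmodP I) => I0 ID _ _ Is; rewrite big_seq.
by apply: big_ind => // t; apply: Is.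
Qed.

Definition mul_set (D : idomainType) (I J : set {fraction D}) :
    set {fraction D} :=
  [set z | exists2 s : seq ({fraction D} * {fraction D}),
     (forall p, p \in s -> I p.1 /\ J p.2) & z = \sum_(p <- s) p.1 * p.2].

Lemma mul_set1 (D : idomainType) (I J : set {fraction D}) x y :
  I x -> J y -> mul_set I J (x * y).
Proof.
move=> Ix Jy; exists [:: (x, y)]; last by rewrite big_seq1.
by move=> p; rewrite inE => /eqP ->.
Qed.

Lemma mul_setP (D : idomainType) (I J : nzsubmod D) : is_nzsubmod (mul_set I J).
Proof.
case: (nzsubmodP I) => I0 ID IZ [x Ix x0]; case: (nzsubmodP J) => _ _ _ [y Jy y0].
split.
- by exists [::]; rewrite ?big_nil.
- move=> _ _ [s sP ->] [t tP ->]; exists (s ++ t); last by rewrite big_cat.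
  by move=> p; rewrite mem_cat => /orP[/sP|/tP].
- move=> r _ [s sP ->].
  exists [seq (FracField.tofrac r * p.1, p.2) | p <- s].
    by move=> _ /mapP[p /sP[Ip Jp] ->]; split=> //=; apply: IZ.
  by rewrite big_map mulr_sumr; apply: eq_bigr => p _; rewrite mulrA.
- by exists (x * y); [exact: mul_set1 | rewrite mulf_neq0].
Qed.

Definition nzsubmod_mul (D : idomainType) (I J : nzsubmod D) : nzsubmod D :=
  NzSubmod (mul_setP I J).

HB.instance Definition _ (D : idomainType) :=
  hasMul.Build (nzsubmod D) (@nzsubmod_mul D).

Lemma nzsubmod_mul_subP (D : idomainType) (I J K : nzsubmod D) :
  ((I * J)%g <= K)%O <-> (forall x y, I x -> J y -> K (x * y)).
Proof.
split=> [/nzsubmod_leP IJK x y Ix Jy|IJK]; first exact/IJK/mul_set1.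
apply/nzsubmod_leP => _ [s sP ->]; apply: nzsubmod_sum => p /sP[Ip Jp].
exact: IJK.
Qed.

Lemma nzsubmod_leM (D : idomainType) (I I' J J' : nzsubmod D) :
  (I <= I')%O -> (J <= J')%O -> ((I * J)%g <= (I' * J')%g)%O.
Proof.
move=> /nzsubmod_leP II' /nzsubmod_leP JJ'; apply/nzsubmod_mul_subP => x y Ix Jy.
by apply: mul_set1; [exact: II' | exact: JJ'].
Qed.

HB.instance Definition _ (D : idomainType) :=
  isOrderedMagma.Build nzsubmod_display (nzsubmod D) (@nzsubmod_leM D).

Lemma nzsubmod_mulC (D : idomainType) :
  commutative (fun I J : nzsubmod D => (I * J)%g).
Proof.
have sub I J : ((I * J)%g <= (J * I)%g :> nzsubmod D)%O.
  by apply/nzsubmod_mul_subP => x y Ix Jy; rewrite mulrC; apply: mul_set1.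
by move=> I J; apply: le_anti; rewrite !sub.
Qed.

Lemma nzsubmod_mulA (D : idomainType) :
  associative (fun I J : nzsubmod D => (I * J)%g).
Proof.
have sub I J K : ((I * (J * K))%g <= (I * J * K)%g :> nzsubmod D)%O.
  apply/nzsubmod_mul_subP => x _ Ix [s sP ->]; rewrite mulr_sumr.
  apply: nzsubmod_sum => p /sP[Jp Kp]; rewrite mulrA.
  by apply: mul_set1 => //; apply: mul_set1.
move=> I J K; apply: le_anti; rewrite sub /=.
rewrite (nzsubmod_mulC (I * J)%g) (nzsubmod_mulC I J).
by rewrite (nzsubmod_mulC I (J * K)%g) (nzsubmod_mulC J K) sub.
Qed.

Lemma dom_setP (D : idomainType) : is_nzsubmod (range (@FracField.tofrac D)).
Proof.
split.
- by exists 0 => //; rewrite tofrac0.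
- by move=> _ _ [a _ <-] [b _ <-]; exists (a + b) => //; rewrite tofracD.
- by move=> r _ [a _ <-]; exists (r * a) => //; rewrite tofracM.
- by exists 1; rewrite ?oner_neq0 //; exists 1 => //; rewrite tofrac1.
Qed.

(* The unit of the monoid is D itself, viewed inside its quotient field. *)
Definition nzsubmod_one (D : idomainType) : nzsubmod D := NzSubmod (dom_setP D).

Lemma nzsubmod_mul1 (D : idomainType) :
  left_id (nzsubmod_one D) (fun I J : nzsubmod D => (I * J)%g).
Proof.
move=> I; apply: le_anti; apply/andP; split.
  apply/nzsubmod_mul_subP => _ y [r _ <-] Iy.
  by case: (nzsubmodP I) => _ _ IZ _; apply: IZ.
apply/nzsubmod_leP => x Ix; rewrite -[x]mul1r; apply: mul_set1 => //.
by exists 1 => //; rewrite tofrac1.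
Qed.

Lemma nzsubmod_mulr1 (D : idomainType) :
  right_id (nzsubmod_one D) (fun I J : nzsubmod D => (I * J)%g).
Proof. by move=> I; rewrite nzsubmod_mulC nzsubmod_mul1. Qed.

HB.instance Definition _ (D : idomainType) :=
  Magma_isSemigroup.Build (nzsubmod D) (@nzsubmod_mulA D).
HB.instance Definition _ (D : idomainType) :=
  Magma_isUMagma.Build (nzsubmod D) (@nzsubmod_mul1 D) (@nzsubmod_mulr1 D).

Definition sum_set (D : idomainType) (X : set (nzsubmod D)) :
    set {fraction D} :=
  [set z | exists2 s : seq {fraction D},
     (forall x, x \in s -> exists2 I : nzsubmod D, X I & I x) &
     z = \sum_(x <- s) x].

Lemma sum_setP (D : idomainType) (X : set (nzsubmod D)) :
  X !=set0 -> is_nzsubmod (sum_set X).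
Proof.
case=> I XI; case: (nzsubmodP I) => I0 _ _ [x Ix x0]; split.
- by exists [::]; rewrite ?big_nil.
- move=> _ _ [s sP ->] [t tP ->]; exists (s ++ t); last by rewrite big_cat.
  by move=> p; rewrite mem_cat => /orP[/sP|/tP].
- move=> r _ [s sP ->]; exists [seq FracField.tofrac r * y | y <- s].
    move=> _ /mapP[y /sP[J XJ Jy] ->]; exists J => //.
    by case: (nzsubmodP J) => _ _ JZ _; apply: JZ.
  by rewrite big_map mulr_sumr.
- exists x => //; exists [:: x]; last by rewrite big_seq1.
  by move=> y; rewrite inE => /eqP ->; exists I.
Qed.

Lemma supremums_sum (D : idomainType) (X : set (nzsubmod D)) (X0 : X !=set0) :
  supremums X (NzSubmod (sum_setP X0)).
Proof.
split=> [I XI|J JX].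
  apply/nzsubmod_leP => x Ix; exists [:: x]; last by rewrite big_seq1.
  by move=> y; rewrite inE => /eqP ->; exists I.
apply/nzsubmod_leP => _ [s sP ->]; apply: nzsubmod_sum => x /sP[I XI Ix].
exact: (nzsubmod_leP _ _ (JX _ XI)).
Qed.

Lemma nzsubmod_sup (D : idomainType) (X : set (nzsubmod D)) :
  X !=set0 -> supremums X !=set0.
Proof. by move=> X0; eexists; exact: (supremums_sum X0). Qed.

Lemma nzsubmod_supM (D : idomainType) (A : nzsubmod D)
    (X : set (nzsubmod D)) (S : nzsubmod D) : X !=set0 ->
  supremums X S -> supremums [set (A * I)%g | I in X] (A * S)%g.
Proof.
move=> X0 SX; have -> : S = NzSubmod (sum_setP X0).
  have [ubS lS] := SX; have [ubT lT] := supremums_sum X0.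
  by apply: le_anti; rewrite lS // lT.
have [ubT _] := supremums_sum X0; split.
  by move=> _ [I XI <-]; apply: nzsubmod_leM => //; apply: ubT.
move=> J ubJ; apply/nzsubmod_mul_subP => a _ Aa [s sP ->]; rewrite mulr_sumr.
apply: nzsubmod_sum => x /sP[I XI Ix].
have /nzsubmod_leP : ((A * I)%g <= J)%O by apply: ubJ; exists I.
by apply; apply: mul_set1.
Qed.

HB.instance Definition _ (D : idomainType) :=
  isNearMultLattice.Build nzsubmod_display (nzsubmod D)
    (@nzsubmod_mulC D) (@nzsubmod_sup D) (@nzsubmod_supM D).

Lemma scale_setP (D : idomainType) (a : {fraction D}) (I : nzsubmod D) :
  a != 0 -> is_nzsubmod [set a * x | x in nzsubmod_set I].
Proof.
move=> a0; case: (nzsubmodP I) => I0 ID IZ [x Ix x0]; split.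
- by exists 0; rewrite ?mulr0.
- by move=> _ _ [y Iy <-] [z Iz <-]; exists (y + z); rewrite ?mulrDr //; apply: ID.
- move=> r _ [y Iy <-]; exists (FracField.tofrac r * y); first exact: IZ.
  by rewrite mulrCA.
- by exists (a * x); [exists x | rewrite mulf_neq0].
Qed.

(* The proof that a is nonzero is only needed for aI to be nonzero. *)
Definition nzsubmod_scale (D : idomainType) (a : {fraction D}) (a0 : a != 0)
    (I : nzsubmod D) : nzsubmod D :=
  NzSubmod (scale_setP I a0).

Definition semistar_operation (D : idomainType)
    (star : nzsubmod D -> nzsubmod D) : Prop :=
  closure_operation star /\
  forall (a : {fraction D}) (a0 : a != 0) (I : nzsubmod D),
    star (nzsubmod_scale a0 I) = nzsubmod_scale a0 (star I).

(* Main.v *)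
(* In a commutative ordered monoid, each of (2), (3) and (4) characterizes
   nuclei: setting one argument to the unit in (2) gives (x* y)* = (x y)*, and in
   (4) gives the closure axioms. An ideal I is the union of its principal
   submodules a D, and a D acts by multiplication as scaling by a, so
   a J* = (a J)* for all a in I gives I J* <= (I J)*; conversely, since a D is
   invertible, a nucleus commutes with multiplication by it. *)
Require Import Defs.
From mathcomp Require Import all_boot all_order all_algebra.

Import Order.TTheory GRing.Theory.

Section Nuclei.
Context {d : Order.disp_t} {M : nearMultLatticeType d} {star : M -> M}.
Local Open Scope group_scope.
Local Open Scope order_scope.

Lemma nucleus_star_mul : nucleus star ->
  forall x y, star (star x * star y) = star (x * y).
Proof.
move=> [[ext mono idem] sub] x y; apply: le_anti; apply/andP; split.
  by rewrite -[leRHS]idem mono.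
by apply: mono; apply: leM; apply: ext.
Qed.

(** Both bracketings equal [star (x * y * z)]: an inner [star] is absorbed by starring both factors,
    collapsing the doubled star by idempotence and removing the stars again. *)
Lemma nucleus_star_mulA : nucleus star -> associative (star_mul star).
Proof.
move=> nuc x y z; rewrite /star_mul.
have [[_ _ idem] _] := nuc; have E := nucleus_star_mul nuc.
by rewrite -E idem E -(E (star _)) idem E mulgA.
Qed.

Lemma star_mulA_nucleus : closure_operation star ->
  associative (star_mul star) -> nucleus star.
Proof.
move=> cl A; have [ext mono idem] := cl; split=> // x y.
have El u v : star (star u * v) = star (u * v).
  by have := A 1 u v; rewrite /star_mul !mul1g idem.
have Er u v : star (u * star v) = star (u * v) by rewrite nmlC El nmlC.
by apply: le_trans (ext _) _; rewrite El Er.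
Qed.

Lemma star_mul_nucleus : closure_operation star ->
  (forall x y, star (star x * star y) = star (x * y)) -> nucleus star.
Proof.
by move=> cl E; have [ext _ _] := cl; split=> // x y; rewrite -E.
Qed.

Lemma nucleus_residual : nucleus star ->
  forall x y z, (x * y <= star z) <-> (x * star y <= star z).
Proof.
move=> [[ext mono idem] sub] x y z; split=> xyz; last first.
  by apply: le_trans xyz; apply: leM.
(* The chain is x y* <= x* y* <= (xy)* <= z** = z*. *)
apply: (@le_trans _ _ (star x * star y)); first exact: leM.
by apply: le_trans (sub x y) _; rewrite -[leRHS]idem mono.
Qed.

Lemma residual_nucleus :
  (forall x y z, (x * y <= star z) <-> (x * star y <= star z)) -> nucleus star.
Proof.
move=> R.
have R1 y z : (y <= star z) <-> (star y <= star z).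
  by have := R 1 y z; rewrite !mul1g.
have ext x : x <= star x by exact: (R1 _ _).2.
have idem x : star (star x) = star x.
  by apply: le_anti; rewrite ext andbT; exact: (R1 _ _).1.
split=> [|x y].
  by split=> // x y xy; apply: (R1 _ _).1; apply: le_trans xy (ext y).
(* Starting from xy <= (xy)*, the residual law stars one factor at a time, with commutativity
   swapping them. *)
by apply: (R _ _ _).1; rewrite nmlC; apply: (R _ _ _).1; rewrite nmlC.
Qed.

End Nuclei.

Section Semistar.
Context {D : idomainType}.
Implicit Types (I J : nzsubmod D) (a : {fraction D}).
Local Open Scope ring_scope.

Definition principal {a} (a0 : a != 0) : nzsubmod D :=
  nzsubmod_scale a0 (nzsubmod_one D).

Lemma principal_mul a (a0 : a != 0) I :
  (principal a0 * I)%g = nzsubmod_scale a0 I.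
Proof.
apply: le_anti; apply/andP; split.
  apply/nzsubmod_mul_subP => _ y [_ [r _ <-] <-] Iy.
  exists (FracField.tofrac r * y); last by rewrite mulrA.
  by case: (nzsubmodP I) => _ _ IZ _; apply: IZ.
apply/nzsubmod_leP => _ [x Ix <-]; apply: mul_set1 => //.
by exists 1; rewrite ?mulr1 //; exists 1; rewrite ?tofrac1.
Qed.

Lemma nzsubmod_scaleVK a (a0 : a != 0) (aV0 : a^-1 != 0) I :
  nzsubmod_scale a0 (nzsubmod_scale aV0 I) = I.
Proof.
apply: le_anti; apply/andP; split; apply/nzsubmod_leP.
  by move=> _ [_ [x Ix <-] <-]; rewrite mulVKf.
by move=> x Ix; exists (a^-1 * x); [exists x | rewrite mulVKf].
Qed.

Lemma nzsubmod_scaleK a (a0 : a != 0) (aV0 : a^-1 != 0) I :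
  nzsubmod_scale aV0 (nzsubmod_scale a0 I) = I.
Proof.
apply: le_anti; apply/andP; split; apply/nzsubmod_leP.
  by move=> _ [_ [x Ix <-] <-]; rewrite mulKf.
by move=> x Ix; exists (a * x); [exists x | rewrite mulKf].
Qed.

Lemma semistar_nucleus (star : nzsubmod D -> nzsubmod D) :
  semistar_operation star <-> nucleus star.
Proof.
split=> [[cl scal]|[cl sub]]; have [ext mono idem] := cl; split=> //.
  have half I J : ((I * star J)%g <= star (I * J)%g)%O.
    apply/nzsubmod_mul_subP => a y Ia Jy.
    (* Scaling is defined only by nonzero elements; for a = 0 the product is 0, which lies in every
       submodule. *)
    have [->|a0] := eqVneq a 0.
      by rewrite mul0r; case: (nzsubmodP (star (I * J)%g)).
    have /mono : (nzsubmod_scale a0 J <= (I * J)%g)%O.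
      by apply/nzsubmod_leP => _ [x Jx <-]; apply: mul_set1.
    by rewrite scal => /nzsubmod_leP; apply; exists y.
  (* Applying [half] once on each side gives I* J* <= (I* J)* <= (IJ)** = (IJ)*. *)
  move=> I J; apply: le_trans (half _ _) _; rewrite -[leRHS]idem.
  by apply: mono; rewrite nzsubmod_mulC (nzsubmod_mulC I); apply: half.
have scale_sub a (a0 : a != 0) I :
    (nzsubmod_scale a0 (star I) <= star (nzsubmod_scale a0 I))%O.
  (* Here aI* = (aD) I* <= (aD)* I* <= (aI)*. *)
  rewrite -!principal_mul; apply: le_trans (sub _ _).
  exact: nzsubmod_leM.
move=> a a0 I; apply: le_anti; rewrite scale_sub andbT.
have aV0 : a^-1 != 0 by rewrite invr_eq0.
(* The reverse inclusion comes from [scale_sub] at the inverse of a: writing b for it, b (aI)* <=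
   (baI)* = I*, and multiplying by a gives (aI)* <= aI*. *)
rewrite -[leLHS](nzsubmod_scaleVK a a0 aV0) -!principal_mul.
apply: nzsubmod_leM => //; rewrite !principal_mul.
by apply: le_trans (scale_sub _ _ _) _; rewrite nzsubmod_scaleK.
Qed.

End Semistar.

Theorem theorem1p4 (D : idomainType) (star : nzsubmod D -> nzsubmod D) :
  (semistar_operation star <-> nucleus star) /\
  [<-> semistar_operation star;
       closure_operation star /\ associative (star_mul star);
       closure_operation star /\
         (forall I J : nzsubmod D,
            star (star I * star J)%g = star (I * J)%g);
       forall I J K : nzsubmod D,
         ((I * J)%g <= star K)%O <-> ((I * star J)%g <= star K)%O].
Proof.
split; first exact: semistar_nucleus.
tfae.
- move=> /semistar_nucleus nuc; split; first by case: nuc.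
  exact: nucleus_star_mulA.
- move=> [cl A]; split=> //.
  exact/nucleus_star_mul/star_mulA_nucleus.
- move=> [cl E]; exact/nucleus_residual/star_mul_nucleus.
- by move=> /residual_nucleus /semistar_nucleus.
Qed.
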